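(* Let $G=\Sigma_4$ and let $u,v\in P^d(4)$ be monomials with stabilizers $H=\mathrm{Stab}_G(u)$ and $K=\mathrm{Stab}_G(v)$, and put $L_0=H\cap K$. Choose a transversal $T\subset H$ for the coset space $L_0\backslash H=\{L_0h:h\in H\}$. Suppose there are $H$-fixed polynomials $q_r\in P^{d-r}(4)^H$ $(r>0)$ and $L\in P^d(4)^H$ such that $$u+\sum_{h\in T}v^h+L=\sum_{r>0}\mathrm{Sq}^r(q_r).$$ Then $$\sigma(u)\equiv[K:H\cap K]\,\sigma(v)+N_H(L)\pmod{\mathcal H^d(B(4))},$$ where the index $[K:H\cap K]$ is reduced modulo $2$.
   Context: $P(4)=\mathbf F_2[x_1,\dots,x_4]$, $|x_i|=1$; the total Steenrod square $\mathrm{Sq}=\sum_r\mathrm{Sq}^r$ is the algebra endomorphism with $\mathrm{Sq}(x_i)=x_i+x_i^2$. $\Sigma_4$ acts on the right by algebra automorphisms with $x_i^\eta=x_{\eta(i)}$ and $(f^\eta)^\gamma=f^{\eta\gamma}$ (products of permutations composed accordingly). $B(4)=P(4)^{\Sigma_4}$, and $\mathcal H^d(B(4))=\sum_{r>0}\mathrm{Sq}^r(B^{d-r}(4))$. For a monomial $f$, $\mathrm{Stab}_G(f)=\{\eta\in G:f^\eta=f\}$ and $\sigma(f)=\sum_{\eta\in \mathrm{Stab}_G(f)\backslash G}f^\eta$ is the sum of the distinct monomials in its $G$-orbit. For $H\le G$ and $q\in P(4)^H$, the coset norm is $N_H(q)=\sum_{\eta\in H\backslash G}q^\eta\in B(4)$,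 which is independent of the choice of representatives of the cosets $H\eta$. *)

(* Defs.v *)
(* MathComp, with multivariate polynomials from multinomials. *)
From mathcomp Require Export all_boot all_order all_algebra fingroup perm.
From mathcomp Require Export mpoly.

Set Implicit Arguments.
Unset Strict Implicit.
Unset Printing Implicit Defensive.

Import GRing.Theory.
Local Open Scope ring_scope.

(* The right action f^s with x_i^s = x_(s i) is the library's [msym s f]: since
   [(s * t) i = t (s i)] in ['S_n], one has
   [msym (s * t) f = msym t (msym s f)] (lemma [msymMm]). *)

Definition Sq_total n (f : {mpoly 'F_2[n]}) : {mpoly 'F_2[n]} :=
  f \mPo [tuple 'X_i + 'X_i ^+ 2 | i < n].

(* Sq^r is the part of the total square that raises the degree by r: on the
   homogeneous component of degree e of f, it is the component of degree e + r
   of its total square. The components of degree >= msize f vanish. *)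
Definition Sq n (r : nat) (f : {mpoly 'F_2[n]}) : {mpoly 'F_2[n]} :=
  \sum_(e < msize f) pihomog mdeg (e + r) (Sq_total (pihomog mdeg e f)).

Definition fixed_by n (H : {set 'S_n}) (f : {mpoly 'F_2[n]}) : Prop :=
  {in H, forall s, msym s f = f}.

Definition stab n (f : {mpoly 'F_2[n]}) : {set 'S_n} :=
  [set s | msym s f == f].

Lemma stab_group_set n (f : {mpoly 'F_2[n]}) : group_set (stab f).
Proof.
apply/group_setP; split=> [|s t]; first by rewrite inE msym1m.
rewrite !in_set => /eqP fs /eqP ft.
by apply/eqP; rewrite msymMm fs.
Qed.

Canonical stab_group n (f : {mpoly 'F_2[n]}) := Group (stab_group_set f).

(* MathComp's right cosets [H :* s] are the sets {h s | h in H}. The choice of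
   [repr C] in each coset C is immaterial when q is H-fixed. *)
Definition coset_norm n (H : {set 'S_n}) (q : {mpoly 'F_2[n]}) :
    {mpoly 'F_2[n]} :=
  \sum_(C in rcosets H [set: 'S_n]) msym (repr C) q.

Definition orbit_sum n (f : {mpoly 'F_2[n]}) : {mpoly 'F_2[n]} :=
  coset_norm (stab f) f.

(* Membership in H^d(B(n)). The sum stops at r = d because B^(d - r) = 0 for
   r > d (whereas [d - r] truncates to 0 in nat). *)
Definition sym_hit n (d : nat) (f : {mpoly 'F_2[n]}) : Prop :=
  exists b : nat -> {mpoly 'F_2[n]},
    (forall r : nat, (0 < r <= d)%N ->
       b r \is (d - r).-homog /\ b r \is symmetric) /\
    f = \sum_(1 <= r < d.+1) Sq r (b r).

(* Main.v *)
(** Summing an [H]-fixed polynomial over [H \ G] is a transfer map: it is linear,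
    lands in the symmetric polynomials and commutes with every [Sq^r], so applying
    it to the hypothesis exhibits the norm of the left-hand side as symmetrically
    hit. The transversal sum of [v] is the transfer of [v] from [H :&: K] to [H],
    and transfers compose, so its norm is the transfer of [v] from [H :&: K] to
    [G]; going through [K] instead, which fixes [v], this is [K : H :&: K] times
    the orbit sum of [v]. *)

From HB Require Import structures.
Require Import Defs.
From mathcomp Require Import all_boot all_order all_algebra fingroup perm mpoly.

Set Implicit Arguments.
Unset Strict Implicit.
Unset Printing Implicit Defensive.

Import GRing.Theory.
Local Open Scope ring_scope.

Lemma msym_comp_mpoly n k (R : comNzRingType) (s : 'S_k)
    (lq : n.-tuple {mpoly R[k]}) (p : {mpoly R[n]}) :
  msym s (p \mPo lq) = p \mPo [tuple msym s (tnth lq i) | i < n].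
Proof.
rewrite !comp_mpolyE linear_sum /=; apply: eq_bigr => m _.
rewrite msymZ rmorph_prod /=; congr (_ *: _); apply: eq_bigr => i _.
by rewrite rmorphXn tnth_mktuple.
Qed.

(** Both sides substitute ['X_(s i) + 'X_(s i) ^+ 2] for ['X_i], since the total square treats all
    variables alike. *)
Lemma msym_Sq_total n (s : 'S_n) (f : {mpoly 'F_2[n]}) :
  msym s (Sq_total f) = Sq_total (msym s f).
Proof.
rewrite /Sq_total msym_comp_mpoly msym_mPo; congr (comp_mpoly _ f).
apply: eq_from_tnth => i.
by rewrite !tnth_mktuple msymD rmorphXn /= /msym mmapX mmap1U.
Qed.

Lemma Sq_homogE n r e (f : {mpoly 'F_2[n]}) :
  f \is e.-homog -> Sq r f = pihomog mdeg (e + r) (Sq_total f).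
Proof.
(* The zero polynomial is homogeneous of every degree, but its [msize] is 0, so [e] would not index
   a summand. *)
move=> homf; have [->|nz_f] := eqVneq f 0.
  by rewrite /Sq msize0 big_ord0 /Sq_total comp_mpoly0 pihomog0.
have sz_f : msize f = e.+1.
  have /dhomogP -/(_ _ (mlead_supp nz_f)) <- := homf.
  by rewrite mlead_deg.
have lt_e : (e < msize f)%N by rewrite sz_f.
rewrite /Sq (bigD1 (Ordinal lt_e)) //= (pihomog_dE homf) big1 ?addr0 // => i ne_i.
rewrite (pihomog_ne0 _ homf) ?/Sq_total ?comp_mpoly0 ?pihomog0 //.
by apply: contraNneq ne_i => eq_ei; apply/eqP/val_inj.
Qed.

Lemma msym_homog n (R : comNzRingType) e (s : 'S_n) (f : {mpoly R[n]}) :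
  f \is e.-homog -> msym s f \is e.-homog.
Proof. by rewrite !homog_piE -msym_pihomog => /eqP ->. Qed.

(** A relative form of [coset_norm], which is the case where [B] is the whole symmetric group; the
    general [B] allows summation in stages. *)
Definition transfer n (A B : {set 'S_n}) (f : {mpoly 'F_2[n]}) :
    {mpoly 'F_2[n]} :=
  \sum_(C in rcosets A B) msym (repr C) f.

Section Transfer.

Variable n : nat.
Implicit Types (f : {mpoly 'F_2[n]}) (A B G : {group 'S_n}).

Lemma transfer_is_linear (A B : {set 'S_n}) :
  linear (@transfer n A B).
Proof.
move=> c f g; rewrite /transfer scaler_sumr -big_split /=.
by apply: eq_bigr => C _; rewrite linearP.
Qed.

HB.instance Definition _ (A B : {set 'S_n}) :=
  GRing.isLinear.Build 'F_2 {mpoly 'F_2[n]} {mpoly 'F_2[n]} _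
    (transfer A B) (transfer_is_linear A B).

Lemma transfer_homog (A B : {set 'S_n}) e f :
  f \is e.-homog -> transfer A B f \is e.-homog.
Proof. by move=> homf; apply: rpred_sum => C _; apply: msym_homog. Qed.

(** On degree [e], [Sq r] is a projection of the total square, and both are linear and commute with
    permutations. *)
Lemma Sq_transfer (A B : {set 'S_n}) r e f :
  f \is e.-homog -> Sq r (transfer A B f) = transfer A B (Sq r f).
Proof.
move=> homf; rewrite (Sq_homogE _ homf) (Sq_homogE _ (transfer_homog A B homf)).
rewrite /transfer [Sq_total _]linear_sum linear_sum; apply: eq_bigr => C _ /=.
by rewrite msym_pihomog msym_Sq_total.
Qed.

Lemma msym_repr_rcoset A f s :
  fixed_by A f -> msym (repr (A :* s)%g) f = msym s f.
Proof.
move=> fixf; have [a Aa ->] := rcosetP (mem_repr_rcoset A s).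
by rewrite msymMm fixf.
Qed.

Lemma msym_repr_rcosetM A f s t : fixed_by A f ->
  msym (repr (A :* s :* t)%g) f = msym t (msym (repr (A :* s)%g) f).
Proof.
move=> fixf; rewrite -rcosetM; transitivity (msym (s * t)%g f).
  exact: msym_repr_rcoset.
by rewrite msymMm; apply/congr1/esym; apply: msym_repr_rcoset.
Qed.

(** Right translation by [s] permutes the right cosets of [A], hence the summands. *)
Lemma transfer_symmetric A f :
  fixed_by A f -> transfer A [set: 'S_n] f \is symmetric.
Proof.
move=> fixf; apply/issymP => s; rewrite /transfer linear_sum /=.
rewrite [RHS](reindex (fun C : {set 'S_n} => (C :* s)%g)) /=; last first.
  by exists (fun C => (C :* s^-1)%g) => C _;
    rewrite -mulgA mulg_set1 ?mulgV ?mulVg mulg1.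
apply: eq_big => [C|C /rcosetsP[x _ ->]].
  apply/rcosetsP/rcosetsP => [][x _ eqC].
    by exists (x * s)%g; rewrite ?inE // eqC rcosetM.
  by exists (x * s^-1)%g; rewrite ?inE // rcosetM -eqC -rcosetM mulgV mulg1.
exact/esym/msym_repr_rcosetM.
Qed.

(** Each coset [C] of [A] lies in exactly one coset of [B], namely [B * C]. Those inside [B :* d]
    are the translates by [d] of the cosets of [A] in [B]. *)
Lemma transfer_trans A B G f : A \subset B -> B \subset G -> fixed_by A f ->
  transfer A G f = transfer B G (transfer A B f).
Proof.
move=> sAB sBG fixf; have mulBA x : (B * (A :* x) = B :* x)%g.
  by rewrite mulgA mulGSid.
rewrite [LHS](partition_big (fun C => B * C)%g (mem (rcosets B G))) /=;
  last first.
  by move=> _ /rcosetsP[x Gx ->]; rewrite mulBA; apply/rcosetsP; exists x.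
apply: eq_bigr => D /rcosetsP[y Gy defD]; set d := repr D.
have Dd : D = (B :* d)%g.
  by rewrite defD; apply/esym/rcoset_eqP; rewrite /d defD mem_repr_rcoset.
have Gd : d \in G.
  rewrite /d defD; have [b Bb ->] := rcosetP (mem_repr_rcoset B y).
  exact: groupM (subsetP sBG _ Bb) Gy.
rewrite [RHS]linear_sum /=.
rewrite [LHS](reindex (fun C : {set 'S_n} => (C :* d)%g)) /=; last first.
  by exists (fun C => (C :* d^-1)%g) => C _;
    rewrite -mulgA mulg_set1 ?mulgV ?mulVg mulg1.
apply: eq_big => [C|C /andP[/rcosetsP[x Gx defC] _]].
  apply/andP/rcosetsP => [[/rcosetsP[x Gx eqC] /eqP eqD]|[x Bx ->]].
    exists (x * d^-1)%g; last by rewrite rcosetM -eqC -rcosetM mulgV mulg1.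
    by rewrite -mem_rcoset -Dd -eqD eqC mulBA rcoset_refl.
  rewrite -rcosetM; split; last by rewrite mulBA rcosetM rcoset_id // -Dd.
  by apply/rcosetsP; exists (x * d)%g; rewrite // groupM // (subsetP sBG).
have -> : C = (A :* (x * d^-1))%g by rewrite rcosetM -defC -rcosetM mulgV mulg1.
exact: msym_repr_rcosetM.
Qed.

Lemma transfer_fixed A B f : A \subset B -> fixed_by B f ->
  transfer A B f = (#|B : A|%g)%:R *: f.
Proof.
move=> sAB fixf; rewrite scaler_nat -sumr_const.
apply: eq_bigr => _ /rcosetsP[x Bx ->].
by rewrite msym_repr_rcoset ?fixf // => a /(subsetP sAB); apply: fixf.
Qed.

Lemma sum_transversal A B (T : {set 'S_n}) f :
  A \subset B -> fixed_by A f -> is_transversal T (rcosets A B) B ->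
  \sum_(h in T) msym h f = transfer A B f.
Proof.
move=> sAB fixf trT.
(* Sending [h] to its coset is a bijection from [T] onto [rcosets A B]. *)
rewrite /transfer -{1}(pblock_transversal trT) (big_imset _ (pblock_inj trT)) /=.
have partB := rcosets_partition sAB; have /and3P[/eqP covB _ _] := partB.
apply: eq_bigr => h Th.
have Bh : h \in cover (rcosets A B) by rewrite covB (subsetP (transversal_sub trT)).
have [x _ defP] := rcosetsP (pblock_mem Bh).
have : h \in (A :* x)%g by rewrite -defP mem_pblock.
by rewrite defP => /rcoset_eqP <-; rewrite msym_repr_rcoset.
Qed.

Lemma fixed_by_stab f : fixed_by (stab f) f.
Proof. by move=> s; rewrite inE => /eqP. Qed.

End Transfer.

Lemma opp_mpolyF2 n (f : {mpoly 'F_2[n]}) : - f = f.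
Proof.
have N1 : -1 = 1 :> 'F_2 by apply: val_inj.
by rewrite -scaleN1r N1 scale1r.
Qed.

Theorem lemma5p3 (d : nat) (mu mv : 'X_{1..4})
    (u := 'X_[mu] : {mpoly 'F_2[4]}) (v := 'X_[mv] : {mpoly 'F_2[4]})
    (H := stab u) (K := stab v) (L0 := H :&: K)
    (T : {set 'S_4}) (q : nat -> {mpoly 'F_2[4]}) (L : {mpoly 'F_2[4]})
    (deg_u : mdeg mu = d) (deg_v : mdeg mv = d)
    (transT : is_transversal T (rcosets L0 H) H)
    (q_homog : forall r : nat, (0 < r <= d)%N -> q r \is (d - r).-homog)
    (q_fixed : forall r : nat, (0 < r <= d)%N -> fixed_by H (q r))
    (L_homog : L \is d.-homog) (L_fixed : fixed_by H L)
    (eq_hit : u + \sum_(h in T) msym h v + L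
              = \sum_(1 <= r < d.+1) Sq r (q r)) :
  sym_hit d (orbit_sum u
             - ((#|K : H :&: K|%g)%:R *: orbit_sum v + coset_norm H L)).
Proof.
exists (fun r => transfer H [set: 'S_4] (q r)); split=> [r lt_rd|].
  split; first exact/transfer_homog/q_homog.
  exact/transfer_symmetric/q_fixed.
have fixL0 : fixed_by L0 v by move=> s /setIP[_]; apply: fixed_by_stab.
have normT : transfer H [set: 'S_4] (\sum_(h in T) msym h v)
             = (#|K : H :&: K|%g)%:R *: orbit_sum v.
  rewrite (sum_transversal (subsetIl _ _) fixL0 transT).
  rewrite -transfer_trans ?subsetIl ?subsetT //.
  rewrite (@transfer_trans _ _ (stab_group v)) ?subsetIr ?subsetT //.
  by rewrite (transfer_fixed (subsetIr _ _) (@fixed_by_stab _ v)) linearZ.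
(* In characteristic 2 the difference is a sum, and [orbit_sum u] is by definition the transfer of
   [u] from [H]. *)
transitivity (transfer H [set: 'S_4] (u + \sum_(h in T) msym h v + L)).
  by rewrite opp_mpolyF2 -normT addrA !linearD.
rewrite eq_hit linear_sum /=.
(* The bounds on [r] are kept because [q r] is known to be homogeneous only within them. *)
rewrite big_nat_cond [RHS]big_nat_cond; apply: eq_bigr => r /andP[lt_rd _].
by rewrite (Sq_transfer _ _ _ (q_homog _ lt_rd)).
Qed.
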